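(* The logics $\mathcal{PL}(\subseteq^{\mathsf r})$ and $\mathcal{QPL}(\subseteq)$ are expressively complete for all union closed team properties containing the empty team. In particular, $$\mathcal{PL}(\subseteq^{\top\bot})\equiv\mathcal{PL}(\subseteq^{\mathsf r})\equiv\mathcal{QPL}(\subseteq)\equiv\mathcal{PL}(\Upsilon).$$ The logics $\mathcal{PL}(\mid^{\mathsf r})$ and $\mathcal{QPL}(\mid)$ are expressively complete for all downward closed team properties containing the empty team. In particular, $$\mathcal{PL}(\mid^{\top\bot})\equiv\mathcal{PL}(\mid^{\mathsf r})\equiv\mathcal{QPL}(\mid)\equiv\mathcal{PL}({=}(\ldots)).$$
   Context: Let $\mathrm{Prop}$ be a countably infinite set of propositional symbols. Formulas of $\mathcal{PL}$: $\phi::=\top\mid\bot\mid p\mid\neg p\mid(\phi\wedge\phi)\mid(\phi\vee\phi)$ with $p\in\mathrm{Prop}$; $\mathcal{QPL}$ additionally allows $\exists p\,\phi$, $\forall p\,\phi$. $\mathrm{FV}(\phi)$ is the set of free propositional symbols (including those in atoms and in relativizing formulas). A team $T$ over a finite set of symbols $V=\mathrm{Var}(T)$ is a set of evaluations $s:V\to\{0,1\}$. For a sequence $\bar p=p_1\dots p_k$, $s(\bar p)=s(p_1)\dots s(p_k)$, with $s(\top)=1$, $s(\bot)=0$. $s(a/p)$ maps $p$ to $a$ and agrees with $s$ elsewhere. Semantics: $T\models\top$ always; $T\models\bot$ iff $T=\emptyset$; $T\models p$ iff $s(p)=1$ for all $s\in T$; $T\models\neg p$ iff $s(p)=0$ for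 all $s\in T$; $T\models\phi\wedge\psi$ iff $T\models\phi$ and $T\models\psi$; $T\models\phi\vee\psi$ iff there are $S,S'\subseteq T$ with $S\cup S'=T$, $S\models\phi$, $S'\models\psi$; $T\models\exists p\,\phi$ iff there is $F:T\to\{\{0\},\{1\},\{0,1\}\}$ with $\{s(a/p)\mid s\in T,a\in F(s)\}\models\phi$; $T\models\forall p\,\phi$ iff $\{s(a/p)\mid s\in T,a\in\{0,1\}\}\models\phi$. For a single evaluation, $s\models\alpha$ ($\alpha\in\mathcal{PL}$) is ordinary satisfaction. Atoms ($|\bar p|=|\bar q|$ for inclusion/exclusion; sequences may be empty): - $T\models\bar p\subseteq\bar q$ iff for all $s\in T$ there is $s'\in T$ with $s(\bar p)=s'(\bar q)$; - $T\models\bar p\mid\bar q$ iff $s(\bar p)\ne s'(\bar q)$ for all $s,s'\in T$; - $T\models{=}(\bar p;q)$ iff for all $s,s'\in T$ with $s(\bar p)=s'(\bar p)$, $s(q)=s'(q)$; - $T\models\bar p\Upsilon q$ iff for all $s\in T$ there is $s'\in T$ with $s(\bar p)=s'(\bar p)$ and $s(q)\ne s'(q)$; - relativized atoms ($\alpha,\beta\in\mathcal{PL}$): $T\models(\bar p;\alpha)\subseteq(\bar q;\beta)$ iff for all $s\in T$, if $s\models\alpha$ then there is $s'\in T$ with $s'(\bar q)=s(\bar p)$ and $s'\models\beta$; $T\models(\bar p;\alpha)\mid(\bar q;\beta)$ iff for all $s,s'\in T$, if $s\models\alpha$ and $s'\models\beta$ then $s(\bar p)\ne s'(\bar q)$.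 $\mathcal{QPL}(\subseteq)$, $\mathcal{QPL}(\mid)$, $\mathcal{PL}(\Upsilon)$, $\mathcal{PL}({=}(\ldots))$ extend $\mathcal{QPL}$ or $\mathcal{PL}$ with the respective (unnegated) atoms over propositional symbols. $\mathcal{PL}(\subseteq^{\mathsf r})$, $\mathcal{PL}(\mid^{\mathsf r})$ extend $\mathcal{PL}$ with relativized inclusion, resp. exclusion, atoms. $\mathcal{PL}(\subseteq^{\top\bot})$ extends $\mathcal{PL}$ with primitive inclusion atoms $\bar x\subseteq\bar p$, $\bar x$ a sequence of constants from $\{\top,\bot\}$ and $\bar p$ a sequence of distinct propositional symbols (semantics as for inclusion). $\mathcal{PL}(\mid^{\top\bot})$ extends $\mathcal{PL}$ with exclusion atoms whose sequences may contain propositional symbols and constants $\top,\bot$. For a tuple $\bar p$ with $\mathrm{FV}(\phi)\subseteq\mathrm{Var}(\bar p)$, $\lVert\phi\rVert^{\bar p}$ is the set of teams over $\bar p$ satisfying $\phi$. A team property over $\bar p$ is a set of teams over $\bar p$; it is union closed if it contains the union of each of its subfamilies, and downward closed if it contains all subsets of its members. A logic is expressively complete for a class of properties if every $\lVert\phi\rVert^{\bar p}$ ($\phi$ in the logic) is in the class, and for every $\bar p$, every property over $\bar p$ in the class equals $\lVert\phi\rVert^{\bar p}$ for some $\phi$ in the logic with $\mathrm{FV}(\phi)\subseteq\mathrm{Var}(\bar p)$. For formulas, $\phi\equiv\psi$ means $\mathrm{FV}(\phi)=\mathrm{FV}(\psi)$ and $T\models\phi\iff T\models\psi$ for all teams $T$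 with $\mathrm{FV}(\phi)\subseteq\mathrm{Var}(T)$. For logics, $\mathcal L_1\equiv\mathcal L_2$ means every formula of each is equivalent to some formula of the other. *)

(* Defs.v *)
From mathcomp Require Import all_boot finmap.

Set Implicit Arguments.
Unset Strict Implicit.
Unset Printing Implicit Defensive.

Local Open Scope fset_scope.

(* Propositional symbols: a fixed countably infinite set. *)
Notation symbol := nat.

(* PL without team atoms: the formulas that may relativize an atom. *)
Inductive pl : Type :=
| PTop
| PBot
| PVar of symbol
| PNeg of symbol
| PAnd of pl & pl
| POr of pl & pl.

(* Entries of inclusion and exclusion atoms; [Cst true] is the constant top and
   [Cst false] is the constant bottom. *)
Inductive term : Type :=
| Sym of symbol
| Cst of bool.

(* [RIncl ps a qs b] is (ps; a) \subseteq (qs; b), and likewise [RExcl].  The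
   side conditions on the sequences (equal lengths, which entries may be
   constants, distinctness) are imposed by the atom classes below. *)
Inductive atom : Type :=
| Incl of seq term & seq term
| Excl of seq term & seq term
| Dep of seq symbol & symbol
| Anon of seq symbol & symbol
| RIncl of seq symbol & pl & seq symbol & pl
| RExcl of seq symbol & pl & seq symbol & pl.

(* One type for the formulas of all the logics; each logic is a predicate on it. *)
Inductive formula : Type :=
| FTop
| FBot
| FVar of symbol
| FNeg of symbol
| FAnd of formula & formula
| FOr of formula & formula
| FEx of symbol & formula
| FAll of symbol & formula
| FAtom of atom.

Definition is_sym (t : term) : bool := if t is Sym _ then true else false.
Definition is_cst (t : term) : bool := if t is Cst _ then true else false.

(* The symbols occurring in a sequence of terms, constants being skipped. *)
Definition symbols (ts : seq term) : seq symbol :=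
  pmap (fun t => if t is Sym p then Some p else None) ts.

Fixpoint pl_fv (a : pl) : {fset symbol} :=
  match a with
  | PTop | PBot => fset0
  | PVar p | PNeg p => [fset p]
  | PAnd a b | POr a b => pl_fv a `|` pl_fv b
  end.

Definition atom_fv (a : atom) : {fset symbol} :=
  match a with
  | Incl ts us | Excl ts us => [fset p in symbols ts ++ symbols us]
  | Dep ps q | Anon ps q => [fset p in q :: ps]
  | RIncl ps a qs b | RExcl ps a qs b =>
      [fset p in ps ++ qs] `|` (pl_fv a `|` pl_fv b)
  end.

Fixpoint fv (f : formula) : {fset symbol} :=
  match f with
  | FTop | FBot => fset0
  | FVar p | FNeg p => [fset p]
  | FAnd f g | FOr f g => fv f `|` fv g
  | FEx p f | FAll p f => fv f `\ p
  | FAtom a => atom_fv a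
  end.

Definition eval (V : {fset symbol}) : finType := {ffun V -> bool}.
Definition team (V : {fset symbol}) : finType := {set eval V}.

(* The value s(p); it is the dummy [false] when [p] is outside the domain, which
   never happens for formulas whose free symbols lie in [V]. *)
Definition val_at (V : {fset symbol}) (s : eval V) (p : symbol) : bool :=
  if insub p is Some x then s x else false.

Definition vals_at (V : {fset symbol}) (s : eval V) (ps : seq symbol) : seq bool :=
  [seq val_at s p | p <- ps].

Definition term_at (V : {fset symbol}) (s : eval V) (t : term) : bool :=
  match t with
  | Sym p => val_at s p
  | Cst b => b
  end.

Definition terms_at (V : {fset symbol}) (s : eval V) (ts : seq term) : seq bool :=
  [seq term_at s t | t <- ts].

(* s(a/p), whose domain is V extended with p (possibly already in V). *)
Definition upd (V : {fset symbol}) (s : eval V) (p : symbol) (a : bool) :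
    eval (p |` V) :=
  [ffun x : (p |` V) => if val x == p then a else val_at s (val x)].

Fixpoint holds (V : {fset symbol}) (s : eval V) (a : pl) : bool :=
  match a with
  | PTop => true
  | PBot => false
  | PVar p => val_at s p
  | PNeg p => ~~ val_at s p
  | PAnd a b => holds s a && holds s b
  | POr a b => holds s a || holds s b
  end.

Definition sat_atom (V : {fset symbol}) (T : team V) (a : atom) : bool :=
  match a with
  | Incl ts us =>
      [forall s in T, exists s' in T, terms_at s ts == terms_at s' us]
  | Excl ts us =>
      [forall s in T, forall s' in T, terms_at s ts != terms_at s' us]
  | Dep ps q =>
      [forall s in T, forall s' in T,
        (vals_at s ps == vals_at s' ps) ==> (val_at s q == val_at s' q)]
  | Anon ps q =>
      [forall s in T, exists s' in T,
        (vals_at s ps == vals_at s' ps) && (val_at s q != val_at s' q)]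
  | RIncl ps a qs b =>
      [forall s in T, holds s a ==>
        [exists s' in T, (vals_at s' qs == vals_at s ps) && holds s' b]]
  | RExcl ps a qs b =>
      [forall s in T, forall s' in T,
        holds s a && holds s' b ==> (vals_at s ps != vals_at s' qs)]
  end.

(* Everything in sight is finite, so satisfaction is boolean.  In the case of
   [FEx], the nonempty subsets of [bool] are {0}, {1} and {0,1}, and the values
   of [F] outside [T] are irrelevant. *)
Fixpoint sat (f : formula) (V : {fset symbol}) (T : team V) {struct f} : bool :=
  match f with
  | FTop => true
  | FBot => T == set0
  | FVar p => [forall s in T, val_at s p]
  | FNeg p => [forall s in T, ~~ val_at s p]
  | FAnd f g => sat f T && sat g T
  | FOr f g =>
      [exists S : team V, exists S' : team V,
        [&& S :|: S' == T, sat f S & sat g S']]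
  | FEx p f =>
      [exists F : {ffun eval V -> {set bool}},
        [forall s in T, F s != set0] &&
        sat f ([set upd s p a | s in T, a in F s] : team (p |` V))]
  | FAll p f => sat f ([set upd s p a | s in T, a in [set: bool]] : team (p |` V))
  | FAtom a => sat_atom T a
  end.

Fixpoint in_logic (quantifiers : bool) (atoms : pred atom) (f : formula) : bool :=
  match f with
  | FTop | FBot | FVar _ | FNeg _ => true
  | FAnd f g | FOr f g =>
      in_logic quantifiers atoms f && in_logic quantifiers atoms g
  | FEx _ f | FAll _ f => quantifiers && in_logic quantifiers atoms f
  | FAtom a => atoms a
  end.

Definition PL (atoms : pred atom) : pred formula := in_logic false atoms.
Definition QPL (atoms : pred atom) : pred formula := in_logic true atoms.

Definition inclusion (a : atom) : bool :=
  if a is Incl ts us then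
    [&& size ts == size us, all is_sym ts & all is_sym us]
  else false.

Definition primitive_inclusion (a : atom) : bool :=
  if a is Incl ts us then
    [&& size ts == size us, all is_cst ts, all is_sym us & uniq (symbols us)]
  else false.

Definition relativized_inclusion (a : atom) : bool :=
  if a is RIncl ps _ qs _ then size ps == size qs else false.

Definition anonymity (a : atom) : bool :=
  if a is Anon _ _ then true else false.

Definition exclusion (a : atom) : bool :=
  if a is Excl ts us then
    [&& size ts == size us, all is_sym ts & all is_sym us]
  else false.

Definition exclusion_with_constants (a : atom) : bool :=
  if a is Excl ts us then size ts == size us else false.

Definition relativized_exclusion (a : atom) : bool :=
  if a is RExcl ps _ qs _ then size ps == size qs else false.

Definition dependence (a : atom) : bool :=
  if a is Dep _ _ then true else false.

Definition property (V : {fset symbol}) : finType := {set team V}.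

Definition team_property_of (V : {fset symbol}) (f : formula) : property V :=
  [set T : team V | sat f T].

Definition union_closed (V : {fset symbol}) (P : property V) : Prop :=
  forall Q : property V, Q \subset P -> (\bigcup_(T in Q) T)%SET \in P.

Definition downward_closed (V : {fset symbol}) (P : property V) : Prop :=
  forall T S : team V, T \in P -> S \subset T -> S \in P.

Definition has_empty_team (V : {fset symbol}) (P : property V) : Prop :=
  (set0 : team V) \in P.

Definition property_class : Type := forall V : {fset symbol}, property V -> Prop.

Definition union_closed_with_empty : property_class :=
  fun V P => union_closed P /\ has_empty_team P.

Definition downward_closed_with_empty : property_class :=
  fun V P => downward_closed P /\ has_empty_team P.

Definition expressively_complete (L : pred formula) (C : property_class) : Prop :=
  (forall (V : {fset symbol}) (f : formula),
     L f -> fv f `<=` V -> C V (team_property_of V f)) /\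
  (forall (V : {fset symbol}) (P : property V),
     C V P -> exists f : formula, [/\ L f, fv f `<=` V & P = team_property_of V f]).

Definition formula_equiv (f g : formula) : Prop :=
  fv f = fv g /\
  forall (V : {fset symbol}) (T : team V), fv f `<=` V -> sat f T = sat g T.

Definition logic_equiv (L1 L2 : pred formula) : Prop :=
  (forall f, L1 f -> exists2 g, L2 g & formula_equiv f g) /\
  (forall g, L2 g -> exists2 f, L1 f & formula_equiv g f).

(* Main.v *)
(* Every formula is local, so two logics that are complete for the same class of
   properties and that can express [p \/ ~ p] are equivalent.  Completeness for
   union closed properties with the empty team reduces to expressing "the team
   is empty or contains [s]": then "the team is empty or equals [T]" is
   expressible, and a disjunction of such formulas over the members [T] of the
   property defines it.  Completeness for downward closed properties with the
   empty team reduces to expressing "the team has at most one element": a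
   [k]-fold disjunction then bounds the size by [k], hence "[T] is not included
   in the team" is expressible as "the team is the union of a team disjoint from
   [T] and of a team with fewer elements than [T]", and the property is defined
   by the conjunction of these formulas over all [T] outside of it. *)

Require Import Defs.
From mathcomp Require Import all_boot finmap.

Set Implicit Arguments.
Unset Strict Implicit.
Unset Printing Implicit Defensive.

Local Open Scope fset_scope.

(** * Locality *)

Lemma val_at_val (V : {fset symbol}) (s : eval V) (x : V) :
  val_at s (val x) = s x.
Proof. by rewrite /val_at valK. Qed.

Lemma eval_eqP (V : {fset symbol}) (s t : eval V) :
  {in V, forall p, val_at s p = val_at t p} -> s = t.
Proof.
move=> st; apply/ffunP => x; rewrite -!val_at_val; exact: st (valP x).
Qed.

Lemma val_at_upd (V : {fset symbol}) (s : eval V) p a q :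
  val_at (upd s p a) q = if q == p then a else val_at s q.
Proof.
rewrite {1}/val_at; case: insubP => [u _ uq | ]; first by rewrite ffunE uq.
(* Here [q] lies outside both domains, so both sides are the default [false]. *)
rewrite in_fset1U negb_or => /andP[/negPf-> qV].
by rewrite /val_at insubN.
Qed.

(** Comparing through [val_at] lets the two domains differ, as for an evaluation and its
    restriction. *)
Definition agree (X V W : {fset symbol}) (s : eval V) (t : eval W) : bool :=
  all (fun p => val_at s p == val_at t p) X.

Lemma agreeP (X V W : {fset symbol}) (s : eval V) (t : eval W) :
  reflect {in X, val_at s =1 val_at t} (agree X s t).
Proof.
by apply: (iffP allP) => st p pX; apply/eqP; [apply: st | rewrite st].
Qed.

Lemma agree_sub (X Y V W : {fset symbol}) (s : eval V) (t : eval W) :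
  X `<=` Y -> agree Y s t -> agree X s t.
Proof. by move=> /fsubsetP XY /agreeP st; apply/agreeP => p /XY /st. Qed.

Lemma agreeC (X V W : {fset symbol}) (s : eval V) (t : eval W) :
  agree X s t = agree X t s.
Proof. by apply: eq_all => p; rewrite eq_sym. Qed.

Lemma agree_upd (X V W : {fset symbol}) (s : eval V) (t : eval W) p a :
  agree (X `\ p) s t -> agree X (upd s p a) (upd t p a).
Proof.
move=> /agreeP st; apply/agreeP => q qX; rewrite !val_at_upd.
by case: eqP => // /eqP qp; rewrite st // in_fsetD1 qp.
Qed.

(** Back-and-forth form of equality of the restrictions of the two teams to [X]. *)
Definition similar (X V W : {fset symbol}) (T : team V) (U : team W) : Prop :=
  (forall s, s \in T -> exists2 t, t \in U & agree X s t) /\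
  (forall t, t \in U -> exists2 s, s \in T & agree X s t).

Lemma similarC (X V W : {fset symbol}) (T : team V) (U : team W) :
  similar X T U -> similar X U T.
Proof.
by case=> TU UT; split=> [t /UT | s /TU] [u]; exists u => //; rewrite agreeC.
Qed.

Lemma similar_sub (X Y V W : {fset symbol}) (T : team V) (U : team W) :
  X `<=` Y -> similar Y T U -> similar X T U.
Proof.
by move=> XY [TU UT]; split=> [t /TU | s /UT] [u ?] /(agree_sub XY); exists u.
Qed.

Lemma agree_vals (X V W : {fset symbol}) (s : eval V) (t : eval W) ps :
  {subset ps <= X} -> agree X s t -> vals_at s ps = vals_at t ps.
Proof. by move=> psX /agreeP st; apply/eq_in_map => p /psX /st. Qed.

Lemma agree_terms (X V W : {fset symbol}) (s : eval V) (t : eval W) ts :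
  {subset symbols ts <= X} -> agree X s t -> terms_at s ts = terms_at t ts.
Proof.
move=> tsX /agreeP st; elim: ts tsX => //= -[p|b] ts IH tsX /=; last first.
  by rewrite IH.
rewrite IH => [|q qts]; last by apply: tsX; rewrite inE qts orbT.
by congr cons; apply: st; apply: tsX; rewrite inE eqxx.
Qed.

Lemma agree_holds (V W : {fset symbol}) (s : eval V) (t : eval W) a :
  agree (pl_fv a) s t -> holds s a = holds t a.
Proof.
elim: a => //= [p|p|a IHa b IHb|a IHa b IHb] st.
- by apply: (agreeP _ _ _ st); rewrite in_fset1.
- by rewrite (agreeP _ _ _ st) // in_fset1.
- by rewrite IHa ?IHb //; apply: agree_sub st; rewrite ?fsubsetUl ?fsubsetUr.
- by rewrite IHa ?IHb //; apply: agree_sub st; rewrite ?fsubsetUl ?fsubsetUr.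
Qed.

(** Universally quantified evaluations are pulled back from [U] to [T], and existential witnesses
    are pushed forward. One implication is enough, since [similar] is symmetric. *)
Lemma sat_atom_local a (V W : {fset symbol}) (T : team V) (U : team W) :
  similar (atom_fv a) T U -> sat_atom T a -> sat_atom U a.
Proof.
case: a => [ts us|ts us|ps q|ps q|ps a qs b|ps a qs b] /= [TU UT].
- have tsX : {subset symbols ts <= [fset p in symbols ts ++ symbols us]}.
    by move=> p pts; rewrite !inE pts.
  have usX : {subset symbols us <= [fset p in symbols ts ++ symbols us]}.
    by move=> p pts; rewrite !inE pts orbT.
  move=> /forall_inP H; apply/forall_inP => t /UT[s /H /exists_inP[s' /TU]].
  move=> [t' t'U /(agree_terms usX) E'] /eqP E /(agree_terms tsX) E''.
  by apply/exists_inP; exists t'; rewrite // -E' -E'' E.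
- have tsX : {subset symbols ts <= [fset p in symbols ts ++ symbols us]}.
    by move=> p pts; rewrite !inE pts.
  have usX : {subset symbols us <= [fset p in symbols ts ++ symbols us]}.
    by move=> p pts; rewrite !inE pts orbT.
  move=> /forall_inP H; apply/forall_inP => t /UT[s /H /forall_inP Hs].
  move=> /(agree_terms tsX) <-; apply/forall_inP => t' /UT[s' /Hs].
  by move=> E /(agree_terms usX) <-.
- have psX : {subset ps <= [fset p in q :: ps]} by move=> p; rewrite !inE orbC => ->.
  have qX : q \in [fset p in q :: ps] by rewrite !inE eqxx.
  move=> /forall_inP H; apply/forall_inP => t /UT[s /H /forall_inP Hs] st.
  apply/forall_inP => t' /UT[s' /Hs E] st'.
  rewrite -(agree_vals psX st) -(agree_vals psX st').
  by rewrite -(agreeP _ _ _ st _ qX) -(agreeP _ _ _ st' _ qX).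
- have psX : {subset ps <= [fset p in q :: ps]} by move=> p; rewrite !inE orbC => ->.
  have qX : q \in [fset p in q :: ps] by rewrite !inE eqxx.
  move=> /forall_inP H; apply/forall_inP => t /UT[s /H /exists_inP[s' /TU]].
  move=> [t' t'U st'] E st; apply/exists_inP; exists t' => //.
  rewrite -(agree_vals psX st) -(agree_vals psX st').
  by rewrite -(agreeP _ _ _ st _ qX) -(agreeP _ _ _ st' _ qX).
- set X := _ `|` _ in TU UT.
  have psX : {subset ps <= X} by move=> p pps; rewrite !inE pps.
  have qsX : {subset qs <= X} by move=> p pqs; rewrite !inE pqs orbT.
  have aX : pl_fv a `<=` X by apply: fsubsetU; rewrite fsubsetUl orbT.
  have bX : pl_fv b `<=` X by apply: fsubsetU; rewrite fsubsetUr orbT.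
  move=> /forall_inP H; apply/forall_inP => t /UT[s /H Hs st].
  rewrite -(agree_holds (agree_sub aX st)) -(agree_vals psX st).
  apply/implyP => sa; have /exists_inP[s' /TU[t' t'U st'] E] := implyP Hs sa.
  apply/exists_inP; exists t' => //.
  by rewrite -(agree_holds (agree_sub bX st')) -(agree_vals qsX st').
- set X := _ `|` _ in TU UT.
  have psX : {subset ps <= X} by move=> p pps; rewrite !inE pps.
  have qsX : {subset qs <= X} by move=> p pqs; rewrite !inE pqs orbT.
  have aX : pl_fv a `<=` X by apply: fsubsetU; rewrite fsubsetUl orbT.
  have bX : pl_fv b `<=` X by apply: fsubsetU; rewrite fsubsetUr orbT.
  move=> /forall_inP H; apply/forall_inP => t /UT[s /H /forall_inP Hs st].
  apply/forall_inP => t' /UT[s' /Hs E st'].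
  rewrite -(agree_holds (agree_sub aX st)) -(agree_vals psX st).
  by rewrite -(agree_holds (agree_sub bX st')) -(agree_vals qsX st').
Qed.

(** Induction on the formula for all domains and teams at once, since a quantifier passes to
    extended domains. *)
Lemma sat_local_imp f (V W : {fset symbol}) (T : team V) (U : team W) :
  similar (fv f) T U -> sat f T -> sat f U.
Proof.
elim: f V W T U => //=.
- move=> V W T U [_ UT] /eqP T0; rewrite -subset0; apply/subsetP => t /UT[s].
  by rewrite T0 inE.
- move=> p V W T U [_ UT] /forall_inP H; apply/forall_inP => t /UT[s /H sp].
  by move=> /agreeP <- //; rewrite in_fset1.
- move=> p V W T U [_ UT] /forall_inP H; apply/forall_inP => t /UT[s /H sp].
  by move=> /agreeP <- //; rewrite in_fset1.
- move=> f IHf g IHg V W T U TU /andP[fT gT]; apply/andP; split.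
    by apply: IHf fT; apply: similar_sub TU; rewrite fsubsetUl.
  by apply: IHg gT; apply: similar_sub TU; rewrite fsubsetUr.
- move=> f IHf g IHg V W T U [TU UT] /existsP[S /existsP[S' /and3P[/eqP E fS gS']]].
  (* A splitting of [T] is carried to [U]: each part goes to the evaluations of [U] that agree with
     one of its members. *)
  pose image (R : team V) : team W :=
    [set t in U | [exists s in R, agree (fv f `|` fv g) s t]].
  have imageP (R : team V) : R \subset T -> similar (fv f `|` fv g) R (image R).
    move=> /subsetP RT; split=> [s sR | t].
      have [t tU st] := TU s (RT s sR); exists t => //.
      by rewrite inE tU; apply/exists_inP; exists s.
    by rewrite inE => /andP[_ /exists_inP[s ? ?]]; exists s.
  apply/existsP; exists (image S); apply/existsP; exists (image S').
  apply/and3P; split.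
  + apply/eqP/setP => t; rewrite !inE; have [tU|//] := boolP (t \in U).
    have [s sT st] := UT t tU; move: sT; rewrite -E inE /=.
    by case/orP => sS; apply/orP; [left|right]; apply/exists_inP; exists s.
  + apply: IHf fS; apply: similar_sub (fsubsetUl _ _) (imageP S _).
    by rewrite -E subsetUl.
  + apply: IHg gS'; apply: similar_sub (fsubsetUr _ _) (imageP S' _).
    by rewrite -E subsetUr.
- move=> p f IHf V W T U [TU UT] /existsP[F /andP[/forall_inP F0 fF]].
  (* Several [s] may agree with the same [t] apart from [p]; [t] receives the union of their
     choices, which set-valued choice functions permit. *)
  pose G : {ffun eval W -> {set bool}} :=
    [ffun t => \bigcup_(s in T | agree (fv f `\ p) s t) F s]%SET.
  apply/existsP; exists G; apply/andP; split.
    apply/forall_inP => t /UT[s sT st]; have /set0Pn[a aF] := F0 s sT.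
    apply/set0Pn; exists a; rewrite ffunE; apply/bigcupP.
    by exists s => //; rewrite sT.
  apply: IHf fF; split=> [_ /imset2P[s a sT aF ->] | _ /imset2P[t a tU aG ->]].
    have [t tU st] := TU s sT; exists (upd t p a); last exact: agree_upd.
    apply: imset2_f => //; rewrite ffunE; apply/bigcupP.
    by exists s => //; rewrite sT.
  move: aG; rewrite ffunE => /bigcupP[s /andP[sT st] aF].
  by exists (upd s p a); [apply: imset2_f | apply: agree_upd].
- move=> p f IHf V W T U [TU UT]; apply: IHf.
  split=> [_ /imset2P[s a sT aF ->] | _ /imset2P[t a tU aG ->]].
    have [t tU st] := TU s sT.
    by exists (upd t p a); [apply: imset2_f | apply: agree_upd].
  have [s sT st] := UT t tU.
  by exists (upd s p a); [apply: imset2_f | apply: agree_upd].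
- by move=> a V W T U; apply: sat_atom_local.
Qed.

Lemma sat_local f (V W : {fset symbol}) (T : team V) (U : team W) :
  similar (fv f) T U -> sat f T = sat f U.
Proof.
by move=> TU; apply/idP/idP; apply: sat_local_imp => //; apply: similarC.
Qed.

Definition restrict (X V : {fset symbol}) (s : eval V) : eval X :=
  [ffun x : X => val_at s (val x)].

Lemma agree_restrict (X V : {fset symbol}) (s : eval V) :
  agree X s (restrict X s).
Proof.
apply/agreeP => p pX; rewrite -[p]/(val [` pX]) val_at_val.
by rewrite /restrict ffunE.
Qed.

Lemma similar_restrict (X V : {fset symbol}) (T : team V) :
  similar X T [set restrict X s | s in T]%SET.
Proof.
split=> [s sT | _ /imsetP[s sT ->]].
  by exists (restrict X s); [apply: imset_f | apply: agree_restrict].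
by exists s => //; apply: agree_restrict.
Qed.

(** * Closure properties *)

(** The empty team property: literals and atoms quantify universally over the team, and the empty
    team splits into and updates to empty teams. *)
Lemma sat_set0 f (V : {fset symbol}) : sat f (set0 : team V).
Proof.
elim: f V => //=.
- by move=> p V; apply/forall_inP => s; rewrite inE.
- by move=> p V; apply/forall_inP => s; rewrite inE.
- by move=> f IHf g IHg V; rewrite IHf IHg.
- move=> f IHf g IHg V; apply/existsP; exists set0; apply/existsP; exists set0.
  by rewrite setU0 eqxx IHf IHg.
- move=> p f IHf V; apply/existsP; exists [ffun => setT]; apply/andP; split.
    by apply/forall_inP => s; rewrite inE.
  set U := (X in sat _ X); suff -> : U = set0 by apply: IHf.
  by apply/setP => t; rewrite inE; apply/imset2P => -[s a]; rewrite inE.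
- move=> p f IHf V; set U := (X in sat _ X); suff -> : U = set0 by apply: IHf.
  by apply/setP => t; rewrite inE; apply/imset2P => -[s a]; rewrite inE.
- by case=> *; apply/forall_inP => s; rewrite inE.
Qed.

(** Splittings and choice functions of the two teams can be united, so union closure is inherited
    from the atoms. *)
Lemma sat_setU q (atoms : pred atom) f (V : {fset symbol}) (T U : team V) :
  (forall a (W : {fset symbol}) (T' U' : team W), atoms a ->
     sat_atom T' a -> sat_atom U' a -> sat_atom (T' :|: U') a) ->
  in_logic q atoms f -> sat f T -> sat f U -> sat f (T :|: U).
Proof.
move=> Hatoms; elim: f V T U => //=.
- by move=> V T U _ /eqP-> /eqP->; rewrite setU0.
- move=> p V T U _ /forall_inP HT /forall_inP HU; apply/forall_inP => s.
  by rewrite inE => /orP[/HT|/HU].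
- move=> p V T U _ /forall_inP HT /forall_inP HU; apply/forall_inP => s.
  by rewrite inE => /orP[/HT|/HU].
- move=> f IHf g IHg V T U /andP[Lf Lg] /andP[fT gT] /andP[fU gU].
  by rewrite IHf ?IHg.
- move=> f IHf g IHg V T U /andP[Lf Lg].
  move=> /existsP[S /existsP[S' /and3P[/eqP<- fS gS']]].
  move=> /existsP[R /existsP[R' /and3P[/eqP<- fR gR']]].
  apply/existsP; exists (S :|: R); apply/existsP; exists (S' :|: R').
  by rewrite IHf ?IHg // setUACA eqxx.
- move=> p f IHf V T U /andP[_ Lf].
  move=> /existsP[F /andP[/forall_inP F0 fF]] /existsP[G /andP[/forall_inP G0 fG]].
  (* Each choice function is masked outside its own team, where its values are arbitrary; on the
     overlap both sets of values are kept. *)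
  apply/existsP; exists [ffun s => (if s \in T then F s else set0) :|:
                                   (if s \in U then G s else set0)].
  apply/andP; split.
    apply/forall_inP => s sTU; rewrite ffunE setU_eq0 negb_and.
    by move: sTU; rewrite inE => /orP[] sT; rewrite sT ?F0 ?G0 ?orbT.
  have := IHf _ _ _ Lf fF fG; congr (is_true (sat f _)).
  apply/setP => t; rewrite inE; apply/orP/imset2P => /=.
    by case=> /imset2P[s a sT aF ->]; exists s a => //; rewrite ?ffunE inE sT ?aF ?orbT.
  case=> s a _; rewrite ffunE inE => /orP[] + ->; case: ifP => [sT aF|_];
    rewrite ?inE //; [left|right]; exact: imset2_f.
- move=> p f IHf V T U /andP[_ Lf] fT fU.
  have := IHf _ _ _ Lf fT fU; congr (is_true (sat f _)).
  apply/setP => t; rewrite inE; apply/orP/imset2P => /=.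
    by case=> /imset2P[s a sT aF ->]; exists s a; rewrite // inE sT ?orbT.
  by case=> s a; rewrite inE => /orP[] sT aT ->; [left|right]; apply: imset2_f.
Qed.

(** Splittings are intersected with [U] and choice functions are kept, so downward closure is
    inherited from the atoms. *)
Lemma sat_subset q (atoms : pred atom) f (V : {fset symbol}) (T U : team V) :
  (forall a (W : {fset symbol}) (T' U' : team W), atoms a ->
     U' \subset T' -> sat_atom T' a -> sat_atom U' a) ->
  in_logic q atoms f -> U \subset T -> sat f T -> sat f U.
Proof.
move=> Hatoms; elim: f V T U => //=.
- by move=> V T U _ + /eqP T0; rewrite T0 subset0.
- move=> p V T U _ /subsetP UT /forall_inP HT; apply/forall_inP => s.
  by move=> /UT/HT.
- move=> p V T U _ /subsetP UT /forall_inP HT; apply/forall_inP => s.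
  by move=> /UT/HT.
- move=> f IHf g IHg V T U /andP[Lf Lg] UT /andP[fT gT].
  by rewrite (IHf _ _ _ Lf UT fT) (IHg _ _ _ Lg UT gT).
- move=> f IHf g IHg V T U /andP[Lf Lg] UT.
  move=> /existsP[S /existsP[S' /and3P[/eqP E fS gS']]].
  apply/existsP; exists (S :&: U); apply/existsP; exists (S' :&: U).
  rewrite (IHf _ _ _ Lf (subsetIl S U) fS) (IHg _ _ _ Lg (subsetIl S' U) gS').
  by rewrite -setIUl E (setIidPr UT) eqxx.
- move=> p f IHf V T U /andP[_ Lf] /subsetP UT.
  move=> /existsP[F /andP[/forall_inP F0 fF]]; apply/existsP; exists F.
  apply/andP; split; first by apply/forall_inP => s /UT /F0.
  apply: IHf fF => //; apply/subsetP => _ /imset2P[s a /UT sT aF ->].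
  exact: imset2_f.
- move=> p f IHf V T U /andP[_ Lf] /subsetP UT; apply: IHf => //.
  by apply/subsetP => _ /imset2P[s a /UT sT aF ->]; apply: imset2_f.
Qed.

(** Atoms of the shape for all, exists: a witness remains available in a larger team. *)
Definition is_inclusion_like (a : atom) : bool :=
  match a with Incl _ _ | RIncl _ _ _ _ | Anon _ _ => true | _ => false end.

(** Atoms of the shape for all, for all, which pass to subteams. *)
Definition is_exclusion_like (a : atom) : bool :=
  match a with Excl _ _ | RExcl _ _ _ _ | Dep _ _ => true | _ => false end.

Lemma sat_atom_setU a (V : {fset symbol}) (T U : team V) :
  is_inclusion_like a -> sat_atom T a -> sat_atom U a -> sat_atom (T :|: U) a.
Proof.
case: a => //= [ts us|ps q|ps a qs b] _ /forall_inP HT /forall_inP HU;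
  apply/forall_inP => s; rewrite inE => /orP[/HT|/HU].
- by case/exists_inP => t tT st; apply/exists_inP; exists t; rewrite ?inE ?tT.
- case/exists_inP => t tT st; apply/exists_inP.
  by exists t; rewrite ?inE ?tT ?orbT.
- by case/exists_inP => t tT st; apply/exists_inP; exists t; rewrite ?inE ?tT.
- case/exists_inP => t tT st; apply/exists_inP.
  by exists t; rewrite ?inE ?tT ?orbT.
- move=> /implyP st; apply/implyP => /st /exists_inP[t tT E].
  by apply/exists_inP; exists t; rewrite ?inE ?tT.
- move=> /implyP st; apply/implyP => /st /exists_inP[t tT E].
  by apply/exists_inP; exists t; rewrite ?inE ?tT ?orbT.
Qed.

Lemma sat_atom_subset a (V : {fset symbol}) (T U : team V) :
  is_exclusion_like a -> U \subset T -> sat_atom T a -> sat_atom U a.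
Proof.
case: a => //= [ts us|ps q|ps a qs b] _ /subsetP UT /forall_inP HT;
  apply/forall_inP => s /UT /HT /forall_inP Hs;
  by apply/forall_inP => t /UT /Hs.
Qed.

(** Families of teams over [V] are finite, so the empty team and binary unions suffice. *)
Lemma union_closed_sat q (atoms : pred atom) (V : {fset symbol}) f :
  subpred atoms is_inclusion_like -> in_logic q atoms f ->
  union_closed_with_empty (team_property_of V f).
Proof.
move=> atomsP Lf; split=> [Q /subsetP QP|]; last by rewrite /has_empty_team inE sat_set0.
rewrite inE; elim/big_rec: _ => [|T U TQ]; first exact: sat_set0.
apply: sat_setU Lf _ => [a W T' U' /atomsP|]; first exact: sat_atom_setU.
by have := QP T TQ; rewrite inE.
Qed.

Lemma downward_closed_sat q (atoms : pred atom) (V : {fset symbol}) f :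
  subpred atoms is_exclusion_like -> in_logic q atoms f ->
  downward_closed_with_empty (team_property_of V f).
Proof.
move=> atomsP Lf; split=> [T S|]; last by rewrite /has_empty_team inE sat_set0.
rewrite !inE => fT ST; apply: sat_subset Lf ST fT => a W T' U' /atomsP.
exact: sat_atom_subset.
Qed.

(** * Iterated connectives *)

Definition big_and (I : Type) (r : seq I) (F : I -> formula) : formula :=
  foldr (fun i f => FAnd (F i) f) FTop r.

Definition big_or (I : Type) (r : seq I) (F : I -> formula) : formula :=
  foldr (fun i f => FOr (F i) f) FBot r.

Lemma sat_and f g (V : {fset symbol}) (T : team V) :
  sat (FAnd f g) T = sat f T && sat g T.
Proof. by []. Qed.

Lemma sat_orP f g (V : {fset symbol}) (T : team V) :
  reflect (exists S S', [/\ T = S :|: S', sat f S & sat g S']) (sat (FOr f g) T).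
Proof.
apply: (iffP existsP) => [[S /existsP[S' /and3P[/eqP<- fS gS']]]|].
  by exists S, S'.
case=> S [S' [-> fS gS']]; exists S; apply/existsP; exists S'.
by apply/and3P.
Qed.

Lemma sat_or f g (V : {fset symbol}) (S S' : team V) :
  sat f S -> sat g S' -> sat (FOr f g) (S :|: S').
Proof. by move=> fS gS'; apply/sat_orP; exists S, S'. Qed.

Lemma sat_big_and (I : eqType) (r : seq I) F (V : {fset symbol}) (T : team V) :
  reflect {in r, forall i, sat (F i) T} (sat (big_and r F) T).
Proof.
elim: r => [|i r IH] /=; first by constructor.
apply: (iffP andP) => [[Fi /IH Fr] j|Fr].
  by rewrite inE => /predU1P[->|/Fr].
split; first by apply: Fr; rewrite inE eqxx.
by apply/IH => j jr; apply: Fr; rewrite inE jr orbT.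
Qed.

Lemma sat_big_or (I : eqType) (r : seq I) F (V : {fset symbol}) (G : I -> team V) :
  {in r, forall i, sat (F i) (G i)} -> sat (big_or r F) (\bigcup_(i <- r) G i)%SET.
Proof.
elim: r => [|i r IH] H; first by rewrite big_nil /=.
rewrite big_cons; apply: sat_or; first by apply: H; rewrite inE eqxx.
by apply: IH => j jr; apply: H; rewrite inE jr orbT.
Qed.

(** Elimination rule in the form of an induction principle, so that its uses never handle the
    splitting itself. *)
Lemma sat_big_or_ind (I : eqType) (r : seq I) F (V : {fset symbol})
    (K : team V -> Prop) (T : team V) :
  K set0 -> (forall S S', K S -> K S' -> K (S :|: S')) ->
  {in r, forall i S, sat (F i) S -> K S} -> sat (big_or r F) T -> K T.
Proof.
move=> K0 KU; elim: r T => [|i r IH] T H; first by move/eqP->.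
move=> /existsP[S /existsP[S' /and3P[/eqP<- FS FS']]]; apply: KU.
  by apply: H FS; rewrite inE eqxx.
by apply: IH FS' => j jr; apply: H; rewrite inE jr orbT.
Qed.

(** Bundles the syntactic demands that [expressively_complete] makes on a defining formula. *)
Definition in_logic_over q (atoms : pred atom) (V : {fset symbol}) f : bool :=
  in_logic q atoms f && (fv f `<=` V).

Section Over.

Variables (q : bool) (atoms : pred atom) (V : {fset symbol}).
Local Notation over := (in_logic_over q atoms V).

Lemma over_and f g : over f -> over g -> over (FAnd f g).
Proof.
by rewrite /in_logic_over /= fsubUset => /andP[-> ->] /andP[-> ->].
Qed.

Lemma over_or f g : over f -> over g -> over (FOr f g).
Proof. exact: over_and. Qed.

Lemma over_big_and (I : eqType) (r : seq I) F :
  {in r, forall i, over (F i)} -> over (big_and r F).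
Proof.
elim: r => [|i r IH] H; first by rewrite /in_logic_over /= fsub0set.
apply: over_and; first by apply: H; rewrite inE eqxx.
by apply: IH => j jr; apply: H; rewrite inE jr orbT.
Qed.

Lemma over_big_or (I : eqType) (r : seq I) F :
  {in r, forall i, over (F i)} -> over (big_or r F).
Proof.
elim: r => [|i r IH] H; first by rewrite /in_logic_over /= fsub0set.
apply: over_or; first by apply: H; rewrite inE eqxx.
by apply: IH => j jr; apply: H; rewrite inE jr orbT.
Qed.

End Over.

(** * Flat formulas *)

Definition lit (p : symbol) (b : bool) : formula := if b then FVar p else FNeg p.

Lemma sat_lit p b (V : {fset symbol}) (T : team V) :
  reflect {in T, forall s, val_at s p = b} (sat (lit p b) T).
Proof.
by case: b; apply: (iffP forall_inP) => H s /H; [| move=> -> | move/negbTE | move=> ->].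
Qed.

Lemma over_lit q (atoms : pred atom) (V : {fset symbol}) p b :
  p \in V -> in_logic_over q atoms V (lit p b).
Proof. by move=> pV; case: b; rewrite /in_logic_over /= fsub1set. Qed.

Section Flat.

Variable V : {fset symbol}.

(** The minterm of [s]. *)
Definition diagram (s : eval V) : formula :=
  big_and V (fun p => lit p (val_at s p)).

Lemma sat_diagram s (T : team V) : sat (diagram s) T = (T \subset [set s]%SET).
Proof.
apply/sat_big_and/subsetP => [H t tT|H p pV].
  by rewrite inE; apply/eqP/eval_eqP => p pV; apply: (sat_lit _ _ _ (H p pV)).
by apply/sat_lit => t /H; rewrite inE => /eqP->.
Qed.

(** The disjunctive normal form of [A]. *)
Definition within (A : team V) : formula := big_or (enum A) diagram.

Lemma sat_within (A T : team V) : sat (within A) T = (T \subset A).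
Proof.
apply/idP/idP => [|TA].
  apply: (sat_big_or_ind (K := fun S => S \subset A)); first exact: sub0set.
    by move=> S S' SA S'A; rewrite subUset SA.
  move=> s; rewrite mem_enum => sA S; rewrite sat_diagram => /subset_trans.
  by apply; rewrite sub1set.
(* The splitting cuts [T] into its intersections with the singletons of elements of [A]. *)
have -> : T = (\bigcup_(s <- enum A) [set t in T | t == s])%SET.
  apply/setP => t; rewrite big_enum; apply/idP/bigcupP => [tT|[s _]].
    by exists t; [apply: (subsetP TA) | rewrite inE tT eqxx].
  by rewrite inE => /andP[].
apply: sat_big_or => s _; rewrite sat_diagram; apply/subsetP => t.
by rewrite !inE => /andP[].
Qed.

Lemma over_diagram q (atoms : pred atom) s : in_logic_over q atoms V (diagram s).
Proof. by apply: over_big_and => p pV; apply: over_lit. Qed.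

Lemma over_within q (atoms : pred atom) A : in_logic_over q atoms V (within A).
Proof. by apply: over_big_or => s _; apply: over_diagram. Qed.

End Flat.

(** * Expressive completeness *)

Section UnionClosed.

Variables (q : bool) (atoms : pred atom).
Hypothesis atoms_inclusion : subpred atoms is_inclusion_like.

Variable member : forall V : {fset symbol}, eval V -> formula.
Hypothesis over_member :
  forall (V : {fset symbol}) (s : eval V), in_logic_over q atoms V (member s).
Hypothesis sat_member : forall (V : {fset symbol}) (s : eval V) (T : team V),
  sat (member s) T = (T == set0) || (s \in T).

(** It also holds of the empty team, which lets disjuncts stay idle in the disjunction over [P]
    below. *)
Let exactly (V : {fset symbol}) (A : team V) : formula :=
  FAnd (within A) (big_and (enum A) (@member V)).

Let sat_exactly (V : {fset symbol}) (A T : team V) :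
  sat (exactly A) T = (T == set0) || (T == A).
Proof.
rewrite /= sat_within; apply/andP/orP => [[TA /sat_big_and AT]|].
  have [|T0] := boolP (T == set0); first by left.
  right; rewrite eqEsubset TA; apply/subsetP => s sA.
  by have := AT s; rewrite mem_enum sat_member (negPf T0); apply.
case=> /eqP->; split; rewrite ?sub0set //; apply/sat_big_and => s.
  by rewrite sat_member eqxx.
by rewrite mem_enum sat_member orbC => ->.
Qed.

Lemma union_closed_complete :
  expressively_complete (in_logic q atoms) union_closed_with_empty.
Proof.
split=> [V f Lf _|V P [PU P0]]; first exact: union_closed_sat Lf.
exists (big_or (enum P) (@exactly V)).
have /andP[Lf fV] : in_logic_over q atoms V (big_or (enum P) (@exactly V)).
  apply: over_big_or => A _; apply: over_and; first exact: over_within.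
  by apply: over_big_and => s _; apply: over_member.
split=> //; apply/setP => T; rewrite inE; apply/idP/idP => [TP|].
  (* All of [T] goes to the disjunct indexed by [T] itself, and the empty team to the others. *)
  have -> : T = (\bigcup_(A <- enum P) (if A == T then T else set0))%SET.
    apply/setP => t; rewrite big_enum; apply/idP/bigcupP => [tT|[A _]].
      by exists T; rewrite ?eqxx.
    by case: ifP => // _; rewrite inE.
  apply: sat_big_or => A _.
  by case: (eqVneq A T) => [->|_]; rewrite sat_exactly eqxx ?orbT.
(* Each part is empty or a member of [P], hence in [P]; closure under binary unions comes from the
   family [[set S; S']]. *)
apply: (sat_big_or_ind (K := fun S => S \in P)) => //.
  move=> S S' SP S'P; have := PU [set S; S']%SET.
  rewrite bigcup_setU !big_set1; apply; apply/subsetP => U.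
  by rewrite !inE => /orP[] /eqP->.
by move=> A; rewrite mem_enum => AP S; rewrite sat_exactly => /orP[] /eqP->.
Qed.

End UnionClosed.

Section DownwardClosed.

Variables (q : bool) (atoms : pred atom).
Hypothesis atoms_exclusion : subpred atoms is_exclusion_like.

Variable subsingleton : {fset symbol} -> formula.
Hypothesis over_subsingleton :
  forall V : {fset symbol}, in_logic_over q atoms V (subsingleton V).
Hypothesis sat_subsingleton : forall (V : {fset symbol}) (T : team V),
  sat (subsingleton V) T = (#|T| <= 1)%N.

Let card_le (V : {fset symbol}) (k : nat) : formula :=
  iter k (FOr (subsingleton V)) FBot.

Let sat_card_le (V : {fset symbol}) k (T : team V) :
  sat (card_le V k) T = (#|T| <= k)%N.
Proof.
elim: k T => [|k IH] T; first by rewrite leqn0 cards_eq0.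
apply/idP/idP => [/sat_orP[S [S' [->]]]|].
  rewrite sat_subsingleton IH => S1 S'k; apply: leq_trans (leq_card_setU _ _) _.
  exact: (leq_add S1 S'k).
have [->|[s sT]] := set_0Vmem T; first by rewrite sat_set0.
(* The element [s] goes to the first disjunct, and the remaining elements, at most [k], to the
   induction hypothesis. *)
rewrite (cardsD1 s) sT -{2}(setD1K sT) => Tk; apply: sat_or.
  by rewrite sat_subsingleton cards1.
by rewrite IH.
Qed.

(** The bound [#|A|.-1] means fewer elements than [A] only for nonempty [A]; for empty [A] the
    formula holds everywhere instead of nowhere. *)
Let not_superset (V : {fset symbol}) (A : team V) : formula :=
  FOr (within (~: A)) (card_le V #|A|.-1).

Let sat_not_superset (V : {fset symbol}) (A T : team V) :
  A != set0 -> sat (not_superset A) T = ~~ (A \subset T).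
Proof.
rewrite -card_gt0 => A0; apply/idP/idP.
  move=> /sat_orP[S [S' [->]]].
  rewrite sat_within sat_card_le => SA S'A; apply/negP => AT.
  (* [S] misses [A], so a team including [A] has all of it in [S'], which is too small. *)
  suff /subset_leq_card AS' : A \subset S'.
    by have := leq_trans AS' S'A; rewrite leqNgt prednK // leqnn.
  apply/subsetP => s sA; have := subsetP AT s sA; rewrite inE => /orP[] //.
  by move/(subsetP SA); rewrite inE sA.
(* [T] splits into its part outside [A] and [T :&: A], a proper subset of [A]. *)
move=> AT; rewrite -(setID T A) setUC; apply: sat_or.
  by rewrite sat_within setDE subsetIr.
rewrite sat_card_le -ltnS prednK //; apply: proper_card.
by rewrite properE subsetIr subsetI subxx andbT.
Qed.

Lemma downward_closed_complete :
  expressively_complete (in_logic q atoms) downward_closed_with_empty.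
Proof.
split=> [V f Lf _|V P [PD P0]]; first exact: downward_closed_sat Lf.
exists (big_and (enum (~: P)) (@not_superset V)).
have /andP[Lf fV] : in_logic_over q atoms V (big_and (enum (~: P)) (@not_superset V)).
  apply: over_big_and => A _; apply: over_or; first exact: over_within.
  elim: #|A|.-1 => [|k IH]; first by rewrite /in_logic_over /= fsub0set.
  exact: over_or.
split=> //; apply/setP => T; rewrite inE; apply/idP/sat_big_and => [TP A|H].
  (* If [T] included some [A] outside [P], downward closure would put [A] in [P]. *)
  rewrite mem_enum inE => AP; rewrite sat_not_superset.
    by apply: contra AP; apply: PD.
  by apply: contraNneq AP => ->.
(* A nonmember [T] would violate its own conjunct; it is nonempty because [P] contains the empty
   team. *)
apply: contraT => TP; have T0 : T != set0 by apply: contraNneq TP => ->.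
by have := H T; rewrite mem_enum inE TP sat_not_superset // subxx => /(_ isT).
Qed.

End DownwardClosed.

(** * Equivalence of logics complete for the same class *)

Lemma logic_equiv_complete q1 q2 (atoms1 atoms2 : pred atom) C :
  expressively_complete (in_logic q1 atoms1) C ->
  expressively_complete (in_logic q2 atoms2) C ->
  logic_equiv (in_logic q1 atoms1) (in_logic q2 atoms2).
Proof.
suff translate q q' (atoms atoms' : pred atom) :
  expressively_complete (in_logic q atoms) C ->
  expressively_complete (in_logic q' atoms') C ->
  forall f, in_logic q atoms f ->
    exists2 g, in_logic q' atoms' g & formula_equiv f g.
  by move=> H1 H2; split; [apply: translate H1 H2 | apply: translate H2 H1].
move=> [sound _] [_ complete] f Lf.
(* The property of [f] over exactly its own free symbols lies in [C], so the other logic defines it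
   over these symbols. *)
have [g [Lg gf E]] := complete _ _ (sound _ _ Lf (fsubset_refl (fv f))).
(* [g] may lack some free symbols of [f]; these tautologies restore them. *)
pose pad := big_and (fv f) (fun p => FOr (FVar p) (FNeg p)).
have /andP[Lpad padf] : in_logic_over q' atoms' (fv f) pad.
  apply: over_big_and => p pf.
  by apply: over_or; [apply: (over_lit _ _ true) | apply: (over_lit _ _ false)].
have satpad (V : {fset symbol}) (T : team V) : sat pad T.
  apply/sat_big_and => p _.
  rewrite -(setID T [set s | val_at s p]); apply: sat_or.
    by apply/forall_inP => s; rewrite !inE => /andP[].
  by apply/forall_inP => s; rewrite !inE => /andP[].
have fpad : fv f `<=` fv pad.
  apply/fsubsetP => p; rewrite /pad -[p \in fv f]/(p \in enum_fset (fv f)).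
  elim: (enum_fset (fv f)) => //= p' r IH.
  by rewrite !inE => /predU1P[->|/IH->]; rewrite ?eqxx ?orbT.
exists (FAnd g pad); first by rewrite /= Lg.
have fvE : fv f = fv (FAnd g pad).
  apply/eqP; rewrite eqEfsubset /= fsubUset gf padf andbT.
  by rewrite fsubsetU // fpad orbT.
(* Locality replaces a team over [V] by its restriction to [fv f], the domain about which [E]
   speaks. *)
split=> // V T _; have TX := similar_restrict (fv f) T.
have TXg : similar (fv (FAnd g pad)) T [set restrict (fv f) s | s in T]%SET.
  by rewrite -fvE.
rewrite (sat_local TX) (sat_local TXg) [RHS]/= satpad andbT.
by move/setP: E => /(_ [set restrict (fv f) s | s in T]%SET); rewrite !inE.
Qed.

(** * Naming constants by quantified symbols *)

Definition fresh (X : {fset symbol}) : symbol := (\max_(p <- X) p).+1.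

Lemma freshP X : fresh X \notin X.
Proof.
apply/negP => /(@leq_bigmax_seq _ _ xpredT id) /(_ isT).
by rewrite ltnn.
Qed.

Definition fix_symbol (p : symbol) (b : bool) (f : formula) : formula :=
  FEx p (FAnd (lit p b) f).

(** The literal forces every choice to be the singleton of [b], so the quantifier merely assigns [b]
    to [p]. *)
Lemma sat_fix_symbol p b f (V : {fset symbol}) (T : team V) :
  sat (fix_symbol p b f) T = sat f [set upd s p b | s in T]%SET.
Proof.
apply/idP/idP => [|fT].
  move=> /existsP[F /andP[/forall_inP F0 /andP[/sat_lit Fb]]].
  congr (is_true (sat f _)).
  have FE s a : s \in T -> a \in F s -> a = b.
    move=> sT aF; have := Fb (upd s p a); rewrite val_at_upd eqxx; apply.
    exact: imset2_f.
  apply/setP => t; apply/imset2P/imsetP => [[s a sT aF ->]|[s sT ->]].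
    by exists s; rewrite // (FE s a).
  have /set0Pn[a aF] := F0 s sT.
  by exists s b; rewrite // -(FE s a).
apply/existsP; exists [ffun => [set b]%SET]; apply/andP; split.
  by apply/forall_inP => s _; rewrite ffunE; apply/set0Pn; exists b; rewrite inE.
have E : [set upd s p a | s in T, a in [ffun=> [set b]%SET] s]%SET =
         [set upd s p b | s in T]%SET.
  apply/setP => t; apply/imset2P/imsetP => [[s a sT]|[s sT ->]].
    by rewrite ffunE inE => /eqP-> ->; exists s.
  by exists s b; rewrite // ffunE inE.
apply/andP; split; last by rewrite E.
rewrite E; apply/sat_lit => _ /imsetP[s _ ->].
by rewrite val_at_upd eqxx.
Qed.

Section Constants.

Variable V : {fset symbol}.

(** Names for bottom and top, distinct from each other because [c1] is fresh for [c0] as well. *)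
Let c0 := fresh V.
Let c1 := fresh (c0 |` V).

Definition name_constant (t : term) : term :=
  if t is Cst b then Sym (if b then c1 else c0) else t.

Lemma is_sym_name_constant ts : all is_sym (map name_constant ts).
Proof. by elim: ts => //= -[p|b]. Qed.

Definition fix_constants (a : atom) : formula :=
  fix_symbol c0 false (fix_symbol c1 true (FAtom a)).

Let fix2 (s : eval V) := upd (upd s c0 false) c1 true.

Lemma terms_at_name_constant ts s : {subset symbols ts <= V} ->
  terms_at (fix2 s) (map name_constant ts) = terms_at s ts.
Proof.
have c0V : c0 \notin V by exact: freshP.
have /norP[c10 c1V] : ~~ ((c1 == c0) || (c1 \in V)).
  by have := freshP (c0 |` V); rewrite in_fset1U.
elim: ts => //= -[p|b] ts IH tsV.
  rewrite IH => [|r rts]; last by apply: tsV; rewrite inE rts orbT.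
  have pV : p \in V by apply: tsV; rewrite inE eqxx.
  congr cons; rewrite /= !val_at_upd.
  case: eqP => [pc|_]; first by rewrite -pc pV in c1V.
  by case: eqP => [pc|_ //]; first by rewrite -pc pV in c0V.
rewrite IH //; congr cons; case: b; rewrite /= !val_at_upd ?eqxx //.
by rewrite eq_sym (negPf c10).
Qed.

Lemma sat_fix_constants a (T : team V) :
  sat (fix_constants a) T = sat_atom [set fix2 s | s in T]%SET a.
Proof.
rewrite !sat_fix_symbol /=; congr (sat_atom _ _).
by rewrite -imset_comp.
Qed.

Lemma sat_fix_incl ts us (T : team V) :
  {subset symbols ts <= V} -> {subset symbols us <= V} ->
  sat (fix_constants (Incl (map name_constant ts) (map name_constant us))) T =
  sat_atom T (Incl ts us).
Proof.
move=> tsV usV; rewrite sat_fix_constants.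
apply/forall_inP/forall_inP => H s sT.
  have /exists_inP[_ /imsetP[s' s'T ->]] := H _ (imset_f fix2 sT).
  rewrite !terms_at_name_constant // => E.
  by apply/exists_inP; exists s'.
case/imsetP: sT => {}s /H /exists_inP[s' s'T E] ->.
by apply/exists_inP; exists (fix2 s'); [apply: imset_f | rewrite !terms_at_name_constant].
Qed.

Lemma sat_fix_excl ts us (T : team V) :
  {subset symbols ts <= V} -> {subset symbols us <= V} ->
  sat (fix_constants (Excl (map name_constant ts) (map name_constant us))) T =
  sat_atom T (Excl ts us).
Proof.
move=> tsV usV; rewrite sat_fix_constants.
apply/forall_inP/forall_inP => H s sT.
  have /forall_inP Hs := H _ (imset_f fix2 sT).
  apply/forall_inP => s' s'T; have := Hs _ (imset_f fix2 s'T).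
  by rewrite !terms_at_name_constant.
case/imsetP: sT => {}s /H /forall_inP Hs ->.
apply/forall_inP => _ /imsetP[s' /Hs E ->].
by rewrite !terms_at_name_constant.
Qed.

Lemma symbols_name_constant ts : {subset symbols ts <= V} ->
  {subset symbols (map name_constant ts) <= c1 |` (c0 |` V)}.
Proof.
elim: ts => //= -[p|b] ts IH tsV r; rewrite /= inE => /predU1P[->|].
- by rewrite !inE (tsV p) ?orbT // inE eqxx.
- by apply: IH => r' r'ts; apply: tsV; rewrite inE r'ts orbT.
- by case: b {tsV}; rewrite !inE eqxx ?orbT.
- exact: IH.
Qed.

(** The names [c0] and [c1] are bound in [fix_constants], so the atom may use them. *)
Lemma over_fix_constants (atoms : pred atom) a :
  atoms a -> {subset atom_fv a <= c1 |` (c0 |` V)} ->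
  in_logic_over true atoms V (fix_constants a).
Proof.
move=> La aV; rewrite /in_logic_over /= La; apply/fsubsetP => p.
rewrite !inE; case: eqVneq => //= pc0; case: eqVneq => //= pc1 /aV.
by rewrite !inE (negPf pc0) (negPf pc1).
Qed.

End Constants.

(** * The eight logics *)

Section Members.

Variable V : {fset symbol}.

(** Coordinates and points follow the same enumeration of [V], so matching them entrywise compares
    whole evaluations. *)
Definition coords : seq term := [seq Sym p | p <- V].
Definition point (s : eval V) : seq term := [seq Cst (val_at s p) | p <- V].

Lemma terms_at_coords (t : eval V) : terms_at t coords = vals_at t V.
Proof. by rewrite /terms_at -map_comp. Qed.

Lemma terms_at_point (s t : eval V) : terms_at t (point s) = vals_at s V.
Proof. by rewrite /terms_at -map_comp. Qed.

Lemma vals_at_inj : injective (fun s : eval V => vals_at s V).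
Proof. by move=> s t /eq_in_map st; apply: eval_eqP. Qed.

Lemma symbols_coords : symbols coords = V.
Proof. by rewrite /symbols /coords; elim: (enum_fset V) => //= p r ->. Qed.

Lemma symbols_point s : symbols (point s) = [::].
Proof. by rewrite /symbols /point; elim: (enum_fset V). Qed.

(** The left-hand value is that of [s] whichever evaluation is tested, so any element of the team
    forces [s] into it. *)
Lemma sat_point_incl s (T : team V) :
  sat_atom T (Incl (point s) coords) = (T == set0) || (s \in T).
Proof.
apply/forall_inP/orP => [H|[/eqP-> t|sT t _]]; last 2 first.
- by rewrite inE.
- by apply/exists_inP; exists s; rewrite // terms_at_point terms_at_coords.
have [->|[t tT]] := set_0Vmem T; first by left.
have /exists_inP[u uT] := H t tT; rewrite terms_at_point terms_at_coords.
by move=> /eqP/vals_at_inj ->; right.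
Qed.

(** The points stand at opposite ends, so the left side at [u] equals the right side at [v] exactly
    when [u = s] and [v = t]. *)
Lemma sat_points_excl s t (T : team V) :
  sat_atom T (Excl (coords ++ point t) (point s ++ coords)) =
  ~~ ((s \in T) && (t \in T)).
Proof.
have E (u v : eval V) : (terms_at u (coords ++ point t) ==
    terms_at v (point s ++ coords)) = (u == s) && (v == t).
  rewrite /terms_at !map_cat -!/(terms_at _ _) !terms_at_point !terms_at_coords.
  rewrite eqseq_cat ?size_map // !(inj_eq vals_at_inj); congr andb; exact: eq_sym.
apply/forall_inP/idP => [H|H u uT]; last first.
  apply/forall_inP => v vT; rewrite E; apply: contra H => /andP[/eqP<- /eqP<-].
  by rewrite uT.
apply/negP => /andP[sT tT]; have /forall_inP /(_ t tT) := H s sT.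
by rewrite E !eqxx.
Qed.

(** Counterpart of [diagram] that can relativize an atom. *)
Definition pl_diagram (s : eval V) : pl :=
  foldr (fun p a => PAnd (if val_at s p then PVar p else PNeg p) a) PTop V.

Lemma holds_pl_diagram s t : holds t (pl_diagram s) = (t == s).
Proof.
have -> : holds t (pl_diagram s) = all (fun p => val_at t p == val_at s p) V.
  rewrite /pl_diagram; elim: (enum_fset V) => //= p r ->.
  by case: (val_at s p) => //=; case: (val_at t p).
apply/allP/eqP => [ts|-> //].
by apply: eval_eqP => p /ts /eqP.
Qed.

Lemma pl_fv_diagram s : pl_fv (pl_diagram s) `<=` V.
Proof.
rewrite /pl_diagram; have: {subset enum_fset V <= V} by [].
elim: (enum_fset V) => [|p r IH] rV /=; first exact: fsub0set.
rewrite fsubUset IH => [|p' p'r]; last by apply: rV; rewrite inE p'r orbT.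
by rewrite andbT; case: ifP => _ /=; rewrite fsub1set; apply: rV; rewrite inE eqxx.
Qed.

End Members.

(** * Logics with union closed atoms *)

Lemma complete_primitive_inclusion :
  expressively_complete (PL primitive_inclusion) union_closed_with_empty.
Proof.
apply: (@union_closed_complete _ _ _
  (fun V s => FAtom (Incl (point s) (coords V)))).
- by case.
- move=> V s; rewrite /in_logic_over /= !size_map eqxx !all_map /=.
  rewrite symbols_coords symbols_point fset_uniq andbT.
  apply/andP; split; first by apply/andP; split; apply/allP.
  by apply/fsubsetP => p; rewrite !inE.
- by move=> V s T; rewrite -sat_point_incl.
Qed.

(** Values of empty sequences always match, so the atom asks of a nonempty team an element
    satisfying the diagram of [s]. *)
Lemma complete_relativized_inclusion :
  expressively_complete (PL relativized_inclusion) union_closed_with_empty.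
Proof.
pose member (V : {fset symbol}) (s : eval V) :=
  FAtom (RIncl [::] PTop [::] (pl_diagram s)).
apply: (@union_closed_complete _ _ _ member); first by case.
  move=> V s; rewrite /in_logic_over /= !fsubUset fsub0set pl_fv_diagram !andbT.
  by apply/fsubsetP => p; rewrite inE.
move=> V s T /=; apply/forall_inP/orP => [H|[/eqP-> t|sT t _]]; last 2 first.
- by rewrite inE.
- by apply/exists_inP; exists s; rewrite ?holds_pl_diagram ?eqxx.
have [->|[t tT]] := set_0Vmem T; first by left.
have /exists_inP[u uT] := H t tT.
by rewrite holds_pl_diagram => /eqP<-; right.
Qed.

Lemma complete_quantified_inclusion :
  expressively_complete (QPL inclusion) union_closed_with_empty.
Proof.
pose member (V : {fset symbol}) (s : eval V) := fix_constants V
  (Incl (map (name_constant V) (point s)) (map (name_constant V) (coords V))).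
apply: (@union_closed_complete _ _ _ member); first by case.
  move=> V s; apply: over_fix_constants => [|p].
    by rewrite /= !size_map eqxx !is_sym_name_constant.
  rewrite /= in_fset mem_cat => /orP[]; apply: symbols_name_constant.
    by rewrite symbols_point.
  by rewrite symbols_coords.
move=> V s T; rewrite sat_fix_incl ?sat_point_incl //.
  by rewrite symbols_point.
by rewrite symbols_coords.
Qed.

(** On a nonempty team [Anon [::] p] says that [p] takes both values. For [p] separating [s] from
    [t], a nonempty team within [[set s; t]] then contains both. [take 1] selects one such [p], or
    none if [s = t]. *)
Lemma complete_anonymity :
  expressively_complete (PL anonymity) union_closed_with_empty.
Proof.
pose differ (V : {fset symbol}) (s t : eval V) : seq symbol :=
  [seq p <- V | val_at s p != val_at t p].
(* Defines "empty or equal to {s, t}"; a team containing [s] is the union of its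
   subteams of that form. *)
pose pair (V : {fset symbol}) (s t : eval V) : formula :=
  FAnd (within [set s; t]%SET) (big_and (take 1 (differ V s t))
    (fun p => FAtom (Anon [::] p))).
apply: (@union_closed_complete _ _ _
  (fun V s => big_or (enum (eval V)) (pair V s))); first by case.
  move=> V s; apply: over_big_or => t _; apply: over_and; first exact: over_within.
  apply: over_big_and => p /mem_take; rewrite mem_filter => /andP[_ pV].
  rewrite /in_logic_over /=; apply/fsubsetP => r; rewrite !inE.
  by rewrite orbF => /eqP->.
move=> V s T; apply/idP/idP.
  apply: (sat_big_or_ind (K := fun S => (S == set0) || (s \in S))).
  - by rewrite eqxx.
  - move=> S S' /orP[/eqP-> | sS]; last by rewrite inE sS orbT.
    by rewrite set0U.
  - move=> t _ S; rewrite sat_and sat_within => /andP[/subsetP Sst /sat_big_and H].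
    have [->|[u uS]] := set_0Vmem S; first by rewrite eqxx.
    apply/orP; right; apply: contraT => sS.
    have St v : v \in S -> v = t.
      move=> vS; have := Sst v vS; rewrite !inE => /orP[] /eqP // vs.
      by rewrite -vs vS in sS.
    (* Without [s], the nonempty [S] is the singleton of [t]: either no symbol separates [s] from
       [t], which then coincide, or [p] has a single value on [S]. *)
    case E: (differ V s t) => [|p r].
      have st : s = t.
        apply: eval_eqP => p pV; apply/eqP; apply: contraT => stp.
        have : p \in differ V s t by rewrite mem_filter stp.
        by rewrite E.
      by rewrite st -(St u uS) uS in sS.
    have /forall_inP /(_ u uS) /exists_inP[v vS] : sat_atom S (Anon [::] p).
      by apply: H; rewrite E /= take0 inE.
    by rewrite /= (St u uS) (St v vS) eqxx.
have [->|T0] /= := eqVneq T set0; first by rewrite sat_set0.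
move=> sT.
have -> : T = (\bigcup_(t <- enum (eval V)) (if t \in T then [set s; t] else set0))%SET.
  apply/setP => u; rewrite big_enum; apply/idP/bigcupP => [uT|[t _]].
    by exists u; rewrite ?inE // uT !inE eqxx orbT.
  by case: ifP => tT; rewrite !inE // => /orP[] /eqP->.
apply: sat_big_or => t _; case: ifP => tT; last exact: sat_set0.
rewrite sat_and sat_within subxx; apply/sat_big_and => p /mem_take; rewrite mem_filter => /andP[stp _].
apply/forall_inP => u; rewrite !inE => /orP[] /eqP->; apply/exists_inP.
  by exists t; rewrite ?inE ?eqxx ?orbT.
by exists s; rewrite ?inE ?eqxx // eq_sym.
Qed.

(** * Logics with downward closed atoms *)

Lemma downward_closed_complete_pairs q (atoms : pred atom)
    (apart : forall V : {fset symbol}, eval V -> eval V -> formula) :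
  subpred atoms is_exclusion_like ->
  (forall (V : {fset symbol}) (s t : eval V),
     in_logic_over q atoms V (apart V s t)) ->
  (forall (V : {fset symbol}) (s t : eval V) (T : team V),
     sat (apart V s t) T = ~~ ((s \in T) && (t \in T))) ->
  expressively_complete (in_logic q atoms) downward_closed_with_empty.
Proof.
move=> atomsP Lapart sat_apart.
(* At most one element means that no two distinct evaluations occur together; each conjunct forbids
   one such pair. *)
pose subsingleton (V : {fset symbol}) :=
  big_and [seq st <- enum {: eval V * eval V} | st.1 != st.2]
    (fun st => apart V st.1 st.2).
apply: (@downward_closed_complete _ _ _ subsingleton) => // [V|V T].
  by apply: over_big_and.
apply/sat_big_and/card_le1_eqP => [H s t sT tT|H [s t]].
  apply/eqP; apply: contraT => st; have := H (t, s).
  by rewrite mem_filter mem_enum sat_apart /= st tT sT => /(_ isT).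
rewrite mem_filter sat_apart /= => /andP[st _].
by apply: contra st => /andP[sT tT]; apply/eqP/H.
Qed.

Lemma complete_exclusion_with_constants :
  expressively_complete (PL exclusion_with_constants) downward_closed_with_empty.
Proof.
apply: (@downward_closed_complete_pairs _ _ (fun V s t =>
  FAtom (Excl (coords V ++ point t) (point s ++ coords V)))); first by case.
  move=> V s t; rewrite /in_logic_over /= !size_cat !size_map eqxx.
  rewrite /symbols !pmap_cat -!/(symbols _) symbols_coords !symbols_point cats0.
  by apply/fsubsetP => p; rewrite !inE orbb.
by move=> V s t T; rewrite -sat_points_excl.
Qed.

(** Values of empty sequences are always equal, so the atom forbids elements satisfying the diagrams
    of [s] and [t] together. *)
Lemma complete_relativized_exclusion :
  expressively_complete (PL relativized_exclusion) downward_closed_with_empty.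
Proof.
apply: (@downward_closed_complete_pairs _ _ (fun V s t =>
  FAtom (RExcl [::] (pl_diagram s) [::] (pl_diagram t)))); first by case.
  move=> V s t; rewrite /in_logic_over /= !fsubUset !pl_fv_diagram !andbT.
  by apply/fsubsetP => p; rewrite inE.
move=> V s t T /=; apply/forall_inP/idP => [H|H u uT]; last first.
  apply/forall_inP => v vT; rewrite !holds_pl_diagram implybF.
  by apply: contra H => /andP[/eqP<- /eqP<-]; rewrite uT.
apply/negP => /andP[sT tT]; have /forall_inP /(_ t tT) := H s sT.
by rewrite !holds_pl_diagram !eqxx.
Qed.

Lemma complete_quantified_exclusion :
  expressively_complete (QPL exclusion) downward_closed_with_empty.
Proof.
have left_fv (V : {fset symbol}) (t : eval V) :
    {subset symbols (coords V ++ point t) <= V}.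
  by rewrite /symbols pmap_cat -!/(symbols _) symbols_coords symbols_point cats0.
have right_fv (V : {fset symbol}) (s : eval V) :
    {subset symbols (point s ++ coords V) <= V}.
  by rewrite /symbols pmap_cat -!/(symbols _) symbols_coords symbols_point.
pose apart (V : {fset symbol}) (s t : eval V) := fix_constants V
  (Excl (map (name_constant V) (coords V ++ point t))
        (map (name_constant V) (point s ++ coords V))).
apply: (@downward_closed_complete_pairs _ _ apart); first by case.
  move=> V s t; apply: over_fix_constants => [|p].
    by rewrite /= !is_sym_name_constant !size_map !size_cat !size_map eqxx.
  by rewrite /= in_fset mem_cat => /orP[]; apply: symbols_name_constant.
by move=> V s t T; rewrite sat_fix_excl // sat_points_excl.
Qed.

(** [Dep [::] p] is the constancy atom; a team on which every symbol of [V] is constant has at most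
    one element. *)
Lemma complete_dependence :
  expressively_complete (PL dependence) downward_closed_with_empty.
Proof.
pose subsingleton (V : {fset symbol}) := big_and V (fun p => FAtom (Dep [::] p)).
apply: (@downward_closed_complete _ _ _ subsingleton); first by case.
  move=> V; apply: over_big_and => p pV; rewrite /in_logic_over /=.
  by apply/fsubsetP => r; rewrite !inE orbF => /eqP->.
move=> V T; apply/sat_big_and/card_le1_eqP => [H s t sT tT|H p _].
  apply: eval_eqP => p pV.
  by have /forall_inP /(_ t tT) /forall_inP /(_ s sT) /eqP := H p pV.
apply/forall_inP => s sT; apply/forall_inP => t tT.
by rewrite (H s t sT tT) !eqxx.
Qed.

Theorem theorem4p7 :
  (expressively_complete (PL relativized_inclusion) union_closed_with_empty /\
   expressively_complete (QPL inclusion) union_closed_with_empty /\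
   logic_equiv (PL primitive_inclusion) (PL relativized_inclusion) /\
   logic_equiv (PL relativized_inclusion) (QPL inclusion) /\
   logic_equiv (QPL inclusion) (PL anonymity)) /\
  (expressively_complete (PL relativized_exclusion) downward_closed_with_empty /\
   expressively_complete (QPL exclusion) downward_closed_with_empty /\
   logic_equiv (PL exclusion_with_constants) (PL relativized_exclusion) /\
   logic_equiv (PL relativized_exclusion) (QPL exclusion) /\
   logic_equiv (QPL exclusion) (PL dependence)).
Proof.
have [ri qi] := (complete_relativized_inclusion, complete_quantified_inclusion).
have [re qe] := (complete_relativized_exclusion, complete_quantified_exclusion).
split; (split; [by [] | split; [by [] | split; [|split]]]).
- exact: logic_equiv_complete complete_primitive_inclusion ri.
- exact: logic_equiv_complete ri qi.
- exact: logic_equiv_complete qi complete_anonymity.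
- exact: logic_equiv_complete complete_exclusion_with_constants re.
- exact: logic_equiv_complete re qe.
- exact: logic_equiv_complete qe complete_dependence.
Qed.
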